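(* Let $\phi: F \to G$ be an epimorphism of groups with kernel $N$. Then there is a natural isomorphism of exact sequences of (right) $G$-modules $$\begin{array}{ccccccccc} 0 & \to & N^{\mathrm{ab}} & \to & D_\phi & \to & IG & \to & 0\\ & & \downarrow & & \downarrow{\scriptstyle\eta} & & \downarrow & & \\ 0 & \to & N^{\mathrm{ab}} & \to & \widehat{F}^{\mathrm{totab}} & \to & \widetilde{G}^{\mathrm{totab}} & \to & 0 . \end{array}$$ That is, both rows are exact sequences of $G$-modules, and there are isomorphisms of $G$-modules, given by the vertical arrows, making the diagram commute.
   Context: All modules are right modules. For a morphism of groups $\phi:F\to G$ and a right $G$-module $M$, a $\phi$-derivation $d:F\to M$ is a function with $d(uv)=d(u)^{\phi v}+d(v)$ for all $u,v\in F$. A $\phi$-derivation $\partial:F\to D$ is universal if for every $\phi$-derivation $d:F\to M$ there is a unique $G$-morphism $d':D\to M$ with $d'\partial=d$. The derived module $D_\phi$ is the $G$-module (unique up to isomorphism) that is the target of a universal $\phi$-derivation $\partial:F\to D_\phi$; explicitly $D_\phi\cong IF\otimes_{\mathbb{Z}F}\mathbb{Z}G$. $IG$ is the augmentation ideal of $\mathbb{Z}G$, with $G$ acting by right multiplication. $N^{\mathrm{ab}}$ is the abelianisation of $N$, with right $G$-action induced by conjugation: $[n]^{\phi v}=[v^{-1}nv]$. Composition in a groupoid is written so that for $g:p\to q$ and $h:q\to r$ the composite is $gh:p\to r$. For a groupoid $H$, the universal abelianisation $H\to H^{\mathrm{totab}}$ is the universal morphism from $H$ to an abelian group (regarded as a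 groupoid with one object). The universal covering groupoid $p:\widetilde{G}\to G$ of the group $G$ has as objects the elements of $G$ and as morphisms the pairs $(g,h):gh\to h$ with $g,h\in G$, composition $(g,hk)(h,k)=(gh,k)$, and $p(g,h)=g$. The group $G$ acts on the right by $(h,g)^k=(h,gk)$. The groupoid $\widehat{F}$ is the pullback of $p:\widetilde{G}\to G$ along $\phi:F\to G$; its objects are the elements of $G$ and its morphisms are pairs $(u,g):(\phi u)g\to g$ with $u\in F$, $g\in G$, with $\bar\phi:\widehat{F}\to\widetilde{G}$, $(u,g)\mapsto(\phi u,g)$, and $q:\widehat{F}\to F$, $(u,g)\mapsto u$. The group $G$ acts on the right of $\widehat{F}$ by $(u,g)^k=(u,gk)$. These actions induce $G$-module structures on $\widehat{F}^{\mathrm{totab}}$ and $\widetilde{G}^{\mathrm{totab}}$. Maps in the rows: $N^{\mathrm{ab}}\to D_\phi$ is induced by the restriction of $\partial$ to $N$; $D_\phi\to IG$ is the $G$-morphism induced by the $\phi$-derivation $u\mapsto\phi(u)-1$; $N^{\mathrm{ab}}\to\widehat{F}^{\mathrm{totab}}$ is induced by the inclusion into $\widehat{F}$ of the vertex group $\widehat{F}(1)$ at the object $1\in G$, which $q$ maps bijectively to $N$; $\widehat{F}^{\mathrm{totab}}\to\widetilde{G}^{\mathrm{totab}}$ is induced by $\bar\phi$. *)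

(* Defs.v *)
From HB Require Import structures.
From mathcomp Require Import all_boot ssralg ssrint boolp.
From mathcomp Require Import generic_quotient ring_quotient.
From mathcomp.multinomials Require Import freeg.

Set Implicit Arguments.
Unset Strict Implicit.
Unset Printing Implicit Defensive.

Import GRing.Theory.

Local Open Scope ring_scope.

(* Groups are arbitrary, possibly infinite [groupType]s, written             *)
(* multiplicatively in [group_scope]; modules and abelian groups are written  *)
(* additively.                                                                *)

(* A right ZG-module is presented as an abelian group with a right action of  *)
(* G by additive maps.                                                        *)
Record gmodule (G : groupType) := GModule {
  gmodule_sort :> zmodType;
  gact : gmodule_sort -> G -> gmodule_sort;
  gactD : forall g, {morph gact^~ g : x y / x + y};
  gact1 : forall x, gact x 1%g = x;
  gactM : forall x g h, gact x (g * h)%g = gact (gact x g) h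
}.

Definition gmodule_morphism (G : groupType) (M M' : gmodule G) (f : M -> M') :=
  zmod_morphism f /\ forall x g, f (gact x g) = gact (f x) g.

Definition gmodule_isomorphism (G : groupType) (M M' : gmodule G)
  (f : M -> M') := gmodule_morphism f /\ bijective f.

Definition short_exact (G : groupType) (A B C : gmodule G)
    (i : A -> B) (p : B -> C) :=
  [/\ gmodule_morphism i, gmodule_morphism p, injective i,
      forall b, p b = 0 <-> exists a, i a = b
    & forall c, exists b, p b = c].

Definition derivation (F G : groupType) (phi : F -> G) (M : gmodule G)
    (d : F -> M) :=
  forall u v, d (u * v)%g = gact (d u) (phi v) + d v.

Definition universal_derivation (F G : groupType) (phi : F -> G)
    (D : gmodule G) (del : F -> D) :=
  derivation phi del /\
  forall (M : gmodule G) (d : F -> M), derivation phi d ->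
    exists d' : D -> M,
      [/\ gmodule_morphism d', forall u, d' (del u) = d u
        & forall d'' : D -> M, gmodule_morphism d'' ->
            (forall u, d'' (del u) = d u) -> d'' =1 d'].

(* The additive group of ZG is [{freeg G}], the free abelian group on G; the  *)
(* augmentation, which sums the coefficients, is [deg].                       *)

Definition zlift (X : choiceType) (A : zmodType) (f : X -> A)
  (x : {freeg X}) : A := fglift (f : X -> zmodule A) x.

Definition freeg_mulr (G : groupType) (x : {freeg G}) (g : G) : {freeg G} :=
  zlift (fun h => << (h * g)%g >>) x.
Arguments freeg_mulr {G} x g.

Section FreeLift.
Variables (X : choiceType) (A : zmodType).

Lemma zlift_is_zmod_morphism (f : X -> A) : zmod_morphism (zlift f).
Proof. exact: (@lift_is_additive _ X (zmodule A) f). Qed.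

HB.instance Definition _ (f : X -> A) :=
  GRing.isZmodMorphism.Build {freeg X} A (zlift f) (zlift_is_zmod_morphism f).

Lemma zliftU (f : X -> A) x : zlift f << x >> = f x.
Proof. by rewrite /zlift liftU scale1r. Qed.

Lemma freeg_ext (f g : {freeg X} -> A) :
  zmod_morphism f -> zmod_morphism g ->
  (forall x, f << x >> = g << x >>) -> f =1 g.
Proof.
move=> fB gB fg z.
pose f_ := GRing.isZmodMorphism.Build _ _ f fB.
pose g_ := GRing.isZmodMorphism.Build _ _ g gB.
pose f1 : {additive {freeg X} -> A} := HB.pack f f_.
pose g1 : {additive {freeg X} -> A} := HB.pack g g_.
rewrite -[z]freeg_sumE -[f]/(f1 : _ -> _) -[g]/(g1 : _ -> _) !raddf_sum.
apply: eq_bigr => x _.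
have -> : << coeff x z *g x >> = << x >> *~ coeff x z :> {freeg X}.
  by rewrite freegU_mulz intz.
by rewrite !raddfMz /= fg.
Qed.

End FreeLift.

Section AugmentationIdeal.
Variable G : groupType.

Definition augmentation_kernel : {pred {freeg G}} := [pred x | deg x == 0].

Fact augmentation_kernel_zmod_closed : zmod_closed augmentation_kernel.
Proof.
split=> [|x y]; rewrite !inE; first by rewrite deg0.
by move=> /eqP x0 /eqP y0; rewrite degB x0 y0.
Qed.

HB.instance Definition _ := GRing.isZmodClosed.Build {freeg G}
  augmentation_kernel augmentation_kernel_zmod_closed.

Definition augmentation_ideal := {x : {freeg G} | augmentation_kernel x}.

HB.instance Definition _ := SubChoice.on augmentation_ideal.
HB.instance Definition _ :=
  [SubChoice_isSubZmodule of augmentation_ideal by <:].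

Lemma freeg_mulrB g : zmod_morphism (freeg_mulr^~ g : {freeg G} -> {freeg G}).
Proof. exact: zlift_is_zmod_morphism. Qed.

Lemma freeg_mulrU (h g : G) : freeg_mulr << h >> g = << (h * g)%g >>.
Proof. exact: zliftU. Qed.

Lemma freeg_mulr1 (x : {freeg G}) : freeg_mulr x 1%g = x.
Proof.
apply: (freeg_ext (freeg_mulrB 1%g)) (x) => // y.
by rewrite freeg_mulrU mulg1.
Qed.

Lemma freeg_mulrM (x : {freeg G}) g h :
  freeg_mulr x (g * h)%g = freeg_mulr (freeg_mulr x g) h.
Proof.
apply: (freeg_ext (freeg_mulrB (g * h)%g)
  (g := fun x => freeg_mulr (freeg_mulr x g) h)) (x).
  by move=> y z; rewrite !freeg_mulrB.
by move=> y; rewrite !freeg_mulrU mulgA.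
Qed.

Lemma deg_freeg_mulr (x : {freeg G}) g : deg (freeg_mulr x g) = deg x.
Proof.
move: x; apply: (@freeg_ext _ int (fun x => deg (freeg_mulr x g)) (@deg G)).
- by move=> y z; rewrite freeg_mulrB degB.
- exact: deg_is_additive.
- by move=> y; rewrite freeg_mulrU !degU.
Qed.

Fact aug_act_subproof (x : augmentation_ideal) g :
  augmentation_kernel (freeg_mulr (val x) g).
Proof. by apply/eqP; rewrite deg_freeg_mulr; apply/eqP/(valP x). Qed.

Definition aug_act (x : augmentation_ideal) g : augmentation_ideal :=
  Sub (freeg_mulr (val x) g) (aug_act_subproof x g).

Fact aug_actD g : {morph aug_act^~ g : x y / x + y}.
Proof.
move=> x y; apply: val_inj => /=.
exact: (raddfD (zlift (fun h => << (h * g)%g >>) : {additive _ -> _})).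
Qed.

Fact aug_act1 x : aug_act x 1%g = x.
Proof. by apply: val_inj; rewrite /= freeg_mulr1. Qed.

Fact aug_actM x g h : aug_act x (g * h)%g = aug_act (aug_act x g) h.
Proof. by apply: val_inj; rewrite /= freeg_mulrM. Qed.

Definition IG : gmodule G := GModule aug_actD aug_act1 aug_actM.

Fact aug_sub1_subproof (g : G) : augmentation_kernel (<< g >> - << 1%g >>).
Proof. by apply/eqP; rewrite degB !degU subrr. Qed.

(* The element g - 1 of IG.                                                   *)
Definition aug_sub1 (g : G) : IG :=
  (Sub (<< g >> - << 1%g >>) (aug_sub1_subproof g) : augmentation_ideal).

End AugmentationIdeal.

Local Obligation Tactic := try by [].

(* Composition is in diagrammatic order: for a : p -> q and b : q -> r,       *)
(* [gcomp a b _] : p -> r.                                                    *)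
Record groupoid := Groupoid {
  gob : Type;
  gmor : Type;
  gsrc : gmor -> gob;
  gtgt : gmor -> gob;
  gid : gob -> gmor;
  gcomp : forall a b, gtgt a = gsrc b -> gmor;
  ginv : gmor -> gmor;
  gsrc_id : forall p, gsrc (gid p) = p;
  gtgt_id : forall p, gtgt (gid p) = p;
  gsrc_comp : forall a b (ab : gtgt a = gsrc b), gsrc (gcomp ab) = gsrc a;
  gtgt_comp : forall a b (ab : gtgt a = gsrc b), gtgt (gcomp ab) = gtgt b;
  gcompA : forall a b c (ab : gtgt a = gsrc b) (bc : gtgt b = gsrc c)
    (ab_c : gtgt (gcomp ab) = gsrc c) (a_bc : gtgt a = gsrc (gcomp bc)),
    gcomp ab_c = gcomp a_bc;
  gcomp1l : forall a (e : gtgt (gid (gsrc a)) = gsrc a), gcomp e = a;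
  gcomp1r : forall a (e : gtgt a = gsrc (gid (gtgt a))), gcomp e = a;
  gsrc_inv : forall a, gsrc (ginv a) = gtgt a;
  gtgt_inv : forall a, gtgt (ginv a) = gsrc a;
  gcompV : forall a (e : gtgt a = gsrc (ginv a)), gcomp e = gid (gsrc a);
  gcompVl : forall a (e : gtgt (ginv a) = gsrc a), gcomp e = gid (gtgt a)
}.

Record groupoid_morphism (H K : groupoid) := GroupoidMorphism {
  mob : gob H -> gob K;
  mmor :> gmor H -> gmor K;
  mmor_src : forall a, gsrc (mmor a) = mob (gsrc a);
  mmor_tgt : forall a, gtgt (mmor a) = mob (gtgt a);
  mmor_id : forall p, mmor (gid p) = gid (mob p);
  mmor_comp : forall a b (ab : gtgt a = gsrc b)
    (fab : gtgt (mmor a) = gsrc (mmor b)), mmor (gcomp ab) = gcomp fab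
}.

Program Definition group_groupoid (G : groupType) : groupoid :=
  @Groupoid unit G (fun=> tt) (fun=> tt) (fun=> 1%g)
    (fun a b _ => (a * b)%g) (fun a => a^-1)%g _ _ _ _ _ _ _ _ _ _ _.
Next Obligation. by move=> ? []. Qed.
Next Obligation. by move=> ? []. Qed.
Next Obligation. by move=> *; rewrite /= mulgA. Qed.
Next Obligation. by move=> *; exact: mul1g. Qed.
Next Obligation. by move=> *; exact: mulg1. Qed.
Next Obligation. by move=> *; exact: mulgV. Qed.
Next Obligation. by move=> *; exact: mulVg. Qed.

Program Definition ab_groupoid (A : zmodType) : groupoid :=
  @Groupoid unit A (fun=> tt) (fun=> tt) (fun=> 0)
    (fun a b _ => a + b) (fun a => - a) _ _ _ _ _ _ _ _ _ _ _.
Next Obligation. by move=> ? []. Qed.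
Next Obligation. by move=> ? []. Qed.
Next Obligation. by move=> *; rewrite /= addrA. Qed.
Next Obligation. by move=> *; exact: add0r. Qed.
Next Obligation. by move=> *; exact: addr0. Qed.
Next Obligation. by move=> *; exact: subrr. Qed.
Next Obligation. by move=> *; exact: addNr. Qed.

(* iota exhibits the abelian group A as H^totab.                              *)
Definition universal_abelianisation (H : groupoid) (A : zmodType)
    (iota : groupoid_morphism H (ab_groupoid A)) :=
  forall (B : zmodType) (f : groupoid_morphism H (ab_groupoid B)),
    exists h : A -> B,
      [/\ zmod_morphism h, forall a, h (iota a) = f a
        & forall h' : A -> B, zmod_morphism h' ->
            (forall a, h' (iota a) = f a) -> h' =1 h].

Record groupoid_action (G : groupType) (H : groupoid) := GroupoidAction {
  act_ob : gob H -> G -> gob H;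
  act_mor : gmor H -> G -> gmor H;
  act_src : forall a k, gsrc (act_mor a k) = act_ob (gsrc a) k;
  act_tgt : forall a k, gtgt (act_mor a k) = act_ob (gtgt a) k;
  act_id : forall p k, act_mor (gid p) k = gid (act_ob p k);
  act_comp : forall a b k (ab : gtgt a = gsrc b)
    (abk : gtgt (act_mor a k) = gsrc (act_mor b k)),
    act_mor (gcomp ab) k = gcomp abk;
  act_ob1 : forall p, act_ob p 1%g = p;
  act_obM : forall p k l, act_ob p (k * l)%g = act_ob (act_ob p k) l;
  act_mor1 : forall a, act_mor a 1%g = a;
  act_morM : forall a k l, act_mor a (k * l)%g = act_mor (act_mor a k) l
}.

(* T is H^totab with the G-module structure induced by an action of G on H:   *)
(* as iota is universal, equivariance determines the module structure.        *)
Definition totab_module (G : groupType) (H : groupoid)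
    (act : groupoid_action G H) (T : gmodule G)
    (iota : groupoid_morphism H (ab_groupoid T)) :=
  universal_abelianisation iota /\
  forall a k, iota (act_mor act a k) = gact (iota a) k.

Section Covering.
Variable G : groupType.

(* The morphism (g, h) : gh -> h.                                             *)
Program Definition covering_groupoid : groupoid :=
  @Groupoid G (G * G)%type (fun a => a.1 * a.2)%g (fun a => a.2)
    (fun p => (1%g, p)) (fun a b _ => ((a.1 * b.1)%g, b.2))
    (fun a => (a.1^-1, a.1 * a.2)%g) _ _ _ _ _ _ _ _ _ _ _.
Next Obligation. by move=> *; rewrite /= mul1g. Qed.
Next Obligation. by move=> a b ab; rewrite /= -mulgA -ab. Qed.
Next Obligation. by move=> *; rewrite /= mulgA. Qed.
Next Obligation. by move=> [? ?] ?; rewrite /= mul1g. Qed.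
Next Obligation. by move=> [? ?] *; rewrite /= mulg1. Qed.
Next Obligation. by move=> *; rewrite /= mulKg. Qed.
Next Obligation. by move=> *; rewrite /= mulgV. Qed.
Next Obligation. by move=> *; rewrite /= mulVg. Qed.

Program Definition covering_proj :
    groupoid_morphism covering_groupoid (group_groupoid G) :=
  @GroupoidMorphism covering_groupoid (group_groupoid G)
    (fun=> tt) (fun a => a.1) _ _ _ _.

Program Definition covering_action : groupoid_action G covering_groupoid :=
  @GroupoidAction G covering_groupoid (fun p k => (p * k)%g)
    (fun a k => (a.1, (a.2 * k)%g)) _ _ _ _ _ _ _ _.
Next Obligation. by move=> *; rewrite /= mulgA. Qed.
Next Obligation. by move=> *; exact: mulg1. Qed.
Next Obligation. by move=> *; exact: mulgA. Qed.
Next Obligation. by move=> [? ?] *; rewrite /= mulg1. Qed.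
Next Obligation. by move=> *; rewrite /= mulgA. Qed.

End Covering.

Lemma mult1 (F G : groupType) (phi : {multiplicative F -> G}) :
  phi 1%g = 1%g.
Proof. by apply: (mulIg (phi 1%g)); rewrite -gmulfM !mul1g. Qed.

Lemma multV (F G : groupType) (phi : {multiplicative F -> G}) u :
  phi u^-1%g = (phi u)^-1%g.
Proof. by apply: (mulIg (phi u)); rewrite -gmulfM !mulVg mult1. Qed.

Section Hat.
Variables (F G : groupType) (phi : {multiplicative F -> G}).

Program Definition group_morphism :
    groupoid_morphism (group_groupoid F) (group_groupoid G) :=
  @GroupoidMorphism (group_groupoid F) (group_groupoid G) id phi _ _ _ _.
Next Obligation. by move=> *; exact: mult1. Qed.
Next Obligation. by move=> *; exact: gmulfM. Qed.

(* The morphism (u, g) : (phi u)g -> g.                                       *)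
Program Definition hat_groupoid : groupoid :=
  @Groupoid G (F * G)%type (fun a => phi a.1 * a.2)%g (fun a => a.2)
    (fun p => (1%g, p)) (fun a b _ => ((a.1 * b.1)%g, b.2))
    (fun a => (a.1^-1, phi a.1 * a.2)%g) _ _ _ _ _ _ _ _ _ _ _.
Next Obligation. by move=> *; rewrite /= mult1 mul1g. Qed.
Next Obligation. by move=> a b ab; rewrite /= gmulfM -mulgA -ab. Qed.
Next Obligation. by move=> *; rewrite /= mulgA. Qed.
Next Obligation. by move=> [? ?] ?; rewrite /= mul1g. Qed.
Next Obligation. by move=> [? ?] *; rewrite /= mulg1. Qed.
Next Obligation. by move=> *; rewrite /= multV mulKg. Qed.
Next Obligation. by move=> *; rewrite /= mulgV. Qed.
Next Obligation. by move=> *; rewrite /= mulVg. Qed.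

Program Definition hat_bar :
    groupoid_morphism hat_groupoid (covering_groupoid G) :=
  @GroupoidMorphism hat_groupoid (covering_groupoid G)
    id (fun a => (phi a.1, a.2)) _ _ _ _.
Next Obligation. by move=> *; rewrite /= mult1. Qed.
Next Obligation. by move=> *; rewrite /= gmulfM. Qed.

Program Definition hat_proj :
    groupoid_morphism hat_groupoid (group_groupoid F) :=
  @GroupoidMorphism hat_groupoid (group_groupoid F)
    (fun=> tt) (fun a => a.1) _ _ _ _.

Program Definition hat_action : groupoid_action G hat_groupoid :=
  @GroupoidAction G hat_groupoid (fun p k => (p * k)%g)
    (fun a k => (a.1, (a.2 * k)%g)) _ _ _ _ _ _ _ _.
Next Obligation. by move=> *; rewrite /= mulgA. Qed.
Next Obligation. by move=> *; exact: mulg1. Qed.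
Next Obligation. by move=> *; exact: mulgA. Qed.
Next Obligation. by move=> [? ?] *; rewrite /= mulg1. Qed.
Next Obligation. by move=> *; rewrite /= mulgA. Qed.

Lemma hat_square a :
  group_morphism (hat_proj a) = covering_proj G (hat_bar a).
Proof. by []. Qed.

Lemma hat_pullback (K : groupoid)
    (f : groupoid_morphism K (group_groupoid F))
    (c : groupoid_morphism K (covering_groupoid G)) :
  (forall a, group_morphism (f a) = covering_proj G (c a)) ->
  exists h : groupoid_morphism K hat_groupoid,
    [/\ forall p, mob h p = mob c p, forall a, hat_proj (h a) = f a,
        forall a, hat_bar (h a) = c a
      & forall h' : groupoid_morphism K hat_groupoid,
          (forall p, mob h' p = mob c p) ->
          (forall a, hat_proj (h' a) = f a) ->
          (forall a, hat_bar (h' a) = c a) -> forall a, h' a = h a].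
Proof.
move=> fc.
have c_src a : (phi (f a) * (c a).2)%g = mob c (gsrc a).
  by have /= -> := fc a; exact: (mmor_src c a).
have c_tgt a : (c a).2 = mob c (gtgt a) by exact: (mmor_tgt c a).
have h_id p : (f (gid p), (c (gid p)).2) = (1%g, mob c p).
  by rewrite (mmor_id f) (mmor_id c).
have h_comp a b (ab : gtgt a = gsrc b) :
    (f (gcomp ab), (c (gcomp ab)).2) = ((f a * f b)%g, (c b).2).
  have fab : gtgt (f a) = gsrc (f b) by [].
  have cab : gtgt (c a) = gsrc (c b) by rewrite mmor_tgt mmor_src ab.
  by rewrite (mmor_comp ab fab) (mmor_comp ab cab).
pose h : groupoid_morphism K hat_groupoid :=
  @GroupoidMorphism K hat_groupoid (mob c) (fun a => (f a, (c a).2))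
    c_src c_tgt h_id (fun a b ab _ => h_comp a b ab).
exists h; split => // [a|h' _ h'f h'c a].
  by have /= := fc a; rewrite /= => ->; case: (mmor c a).
rewrite /= -h'f -h'c /=; exact: surjective_pairing.
Qed.

Definition kernel_pred : {pred F} := [pred u | phi u == 1%g].

Fact kernel_group_closed : group_closed kernel_pred.
Proof.
split; first by rewrite inE mult1.
by move=> u v; rewrite !inE gmulfM multV => /eqP-> /eqP->; rewrite divgg.
Qed.

Definition kernel := {u : F | kernel_pred u}.
HB.instance Definition _ := SubChoice.on kernel.
HB.instance Definition _ :=
  SubChoice_isSubGroup.Build F kernel_pred kernel kernel_group_closed.

Fact kernel_conj_subproof (n : kernel) v : kernel_pred (val n ^ v)%g.
Proof.
case: n => n /= /eqP n1; apply/eqP.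
by rewrite !gmulfM n1 mul1g -gmulfM mulVg mult1.
Qed.

Definition kernel_conj (n : kernel) (v : F) : kernel :=
  Sub (val n ^ v)%g (kernel_conj_subproof n v).

End Hat.

Definition group_abelianisation (N : groupType) (A : zmodType) (ab : N -> A) :=
  {morph ab : m n / (m * n)%g >-> m + n} /\
  forall (B : zmodType) (f : N -> B),
    {morph f : m n / (m * n)%g >-> m + n} ->
    exists h : A -> B,
      [/\ zmod_morphism h, forall n, h (ab n) = f n
        & forall h' : A -> B, zmod_morphism h' ->
            (forall n, h' (ab n) = f n) -> h' =1 h].

(* A is N^ab for N = Ker phi, with [n]^(phi v) = [v^-1 n v].                  *)
Definition kernel_abelianisation (F G : groupType)
    (phi : {multiplicative F -> G}) (A : gmodule G) (ab : kernel phi -> A) :=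
  group_abelianisation ab /\
  forall n v, gact (ab n) (phi v) = ab (kernel_conj n v).

Section AdditivePresentation.
Variables (X : choiceType) (R : X -> X -> X -> Prop).

Definition additive_on (A : zmodType) (f : X -> A) :=
  forall x y z, R x y z -> f z = f x + f y.

Definition universal_additive (A : zmodType) (e : X -> A) :=
  additive_on e /\
  forall (B : zmodType) (f : X -> B), additive_on f ->
    exists h : A -> B,
      [/\ zmod_morphism h, forall x, h (e x) = f x
        & forall h' : A -> B, zmod_morphism h' ->
            (forall x, h' (e x) = f x) -> h' =1 h].

Definition relator (r : {freeg X}) : Prop :=
  forall S : {freeg X} -> Prop, S 0 ->
    (forall s t, S s -> S t -> S (s - t)) ->
    (forall x y z, R x y z -> S (<< z >> - (<< x >> + << y >>))) -> S r.

Definition relators : {pred {freeg X}} := fun r => `[< relator r >].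

Fact relators_zmod_closed : zmod_closed relators.
Proof.
split=> [|s t]; rewrite !unfold_in; first by apply/asboolP => S.
move=> /asboolP Ks /asboolP Kt; apply/asboolP => S S0 SB SR.
exact: SB (Ks S S0 SB SR) (Kt S S0 SB SR).
Qed.

HB.instance Definition _ :=
  GRing.isZmodClosed.Build {freeg X} relators relators_zmod_closed.

Lemma universal_additive_exists :
  exists (A : zmodType) (e : X -> A), universal_additive e.
Proof.
pose Q : zmodType := Quotient.quot relators.
pose piQ : {freeg X} -> Q := \pi_Q%qT.
have piB : zmod_morphism piQ by exact: pi_is_zmod_morphism.
have piD x y : piQ (x + y) = piQ x + piQ y.
  exact: (raddfD (\pi_(Quotient.quot relators)%qT : {additive _ -> _})).
have piE x y : (piQ x = piQ y) <-> (relators (x - y)).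
  split => [/eqP|h]; first by rewrite -Quotient.idealrBE.
  by apply/eqP; rewrite -Quotient.idealrBE.
exists Q, (fun x => piQ << x >>); split => [x y z xyz|B f fR].
  have -> : piQ << x >> + piQ << y >> = piQ (<< x >> + << y >>).
    by rewrite piD.
  by apply/piE/asboolP => S S0 SB SR; apply: SR.
have f0 r : relators r -> zlift f r = 0.
  move/asboolP => /(_ (fun r => zlift f r = 0)); apply; first exact: raddf0.
    by move=> s t s0 t0; rewrite raddfB /= s0 t0 subrr.
  by move=> x y z xyz; rewrite raddfB raddfD /= !zliftU (fR _ _ _ xyz) subrr.
pose h (q : Q) := zlift f (repr q).
have hpi x : h (piQ x) = zlift f x.
  apply/eqP; rewrite -subr_eq0 /h -zlift_is_zmod_morphism f0 //.
  by apply/piE; rewrite /piQ reprK.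
have piK q : piQ (repr q) = q by rewrite /piQ reprK.
have hB : zmod_morphism h.
  by move=> p q; rewrite -(piK p) -(piK q) -piB !hpi raddfB.
exists h; split => // [x|h' h'B h'e q]; first by rewrite hpi zliftU.
rewrite -(piK q); move: (repr q).
apply: (freeg_ext (f := fun x => h' (piQ x)) (g := fun x => h (piQ x))).
- by move=> x y; rewrite piB h'B.
- by move=> x y; rewrite piB hB.
- by move=> x; rewrite h'e hpi zliftU.
Qed.

Lemma universal_additive_gmodule (G : groupType) (act : X -> G -> X) :
  (forall x y z g, R x y z -> R (act x g) (act y g) (act z g)) ->
  (forall (A : zmodType) (f : X -> A), additive_on f ->
     (forall x, f (act x 1%g) = f x) /\
     (forall x g h, f (act x (g * h)%g) = f (act (act x g) h))) ->
  exists (M : gmodule G) (e : X -> M),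
    universal_additive e /\ forall x g, e (act x g) = gact (e x) g.
Proof.
move=> actR actf; have [A [e [eR eU]]] := universal_additive_exists.
have ag g : additive_on (fun x => e (act x g)).
  by move=> x y z /actR - /(_ g) /eR.
have /boolp.choice [a aP] : forall g, exists h : A -> A,
    zmod_morphism h /\ forall x, h (e x) = e (act x g).
  by move=> g; have [h [hB he _]] := eU _ _ (ag g); exists h.
have aD g : {morph (a g) : x y / x + y}.
  have [aB _] := aP g; move=> x y.
  have a0 : a g 0 = 0 by rewrite -{1}[0](subrr 0) aB subrr.
  have aN z : a g (- z) = - a g z by rewrite -sub0r aB a0 sub0r.
  by rewrite -{1}[y]opprK aB aN opprK.
have ext (h h' : A -> A) : zmod_morphism h -> zmod_morphism h' ->
    (forall x, h (e x) = h' (e x)) -> h =1 h'.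
  move=> hB h'B hh'.
  have h'R : additive_on (fun x => h' (e x)).
    move=> x y z xyz; rewrite (eR _ _ _ xyz).
    have h'0 : h' 0 = 0 by rewrite -{1}[0](subrr 0) h'B subrr.
    have h'N t : h' (- t) = - h' t by rewrite -sub0r h'B h'0 sub0r.
    by rewrite -{1}[e y]opprK h'B h'N opprK.
  have [k [_ _ kU]] := eU _ _ h'R.
  by move=> x; rewrite (kU _ hB hh') (kU _ h'B).
have a1 x : a 1%g x = x.
  apply: (ext _ id (aP _).1 _ _ x) => // y.
  by rewrite (aP _).2 (actf _ _ eR).1.
have aM x g h : a (g * h)%g x = a h (a g x).
  apply: (ext _ (a h \o a g) (aP _).1 _ _ x) => [y z|y] /=.
    by rewrite (aP g).1 (aP h).1.
  by rewrite !(aP _).2 (actf _ _ eR).2.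
exists (@GModule G A (fun x g => a g x) aD a1 aM), e; split=> // x g.
by rewrite /= (aP g).2.
Qed.

End AdditivePresentation.

Lemma totab_module_exists (G : groupType) (H : groupoid)
    (act : groupoid_action G H) :
  exists (T : gmodule G) (iota : groupoid_morphism H (ab_groupoid T)),
    totab_module act iota.
Proof.
pose R (a b c : {classic gmor H}) :=
  exists ab : gtgt (a : gmor H) = gsrc (b : gmor H), c = gcomp ab.
have [||T [e [[eR eU] eact]]] :=
    @universal_additive_gmodule {classic gmor H} R G (act_mor act).
- move=> a b _ g [ab ->].
  have abg : gtgt (act_mor act a g) = gsrc (act_mor act b g).
    by rewrite act_tgt act_src ab.
  by exists abg; rewrite (act_comp ab abg).
- by move=> A f _; split=> [x|x g h]; rewrite ?act_mor1 ?act_morM.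
have e_comp a b (ab : gtgt a = gsrc b) : e (gcomp ab) = e a + e b.
  by apply: eR; exists ab.
have e_id p : e (gid p : gmor H) = 0.
  have idp : gtgt (gid (gsrc (gid p : gmor H))) = gsrc (gid p).
    by rewrite gtgt_id.
  apply: (addrI (e (gid p : gmor H))); rewrite addr0.
  by rewrite -{3}(gcomp1l idp) e_comp gsrc_id.
pose iota : groupoid_morphism H (ab_groupoid T) :=
  @GroupoidMorphism H (ab_groupoid T) (fun=> tt) e
    (fun=> erefl) (fun=> erefl) e_id (fun a b ab _ => e_comp a b ab).
exists T, iota; split=> [B f|a k]; last exact: eact.
have fR : additive_on R (f : {classic gmor H} -> B).
  move=> a b _ [ab ->].
  have fab : gtgt (f a) = gsrc (f b) by rewrite !(mmor_src, mmor_tgt) ab.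
  exact: (mmor_comp ab fab).
exact: eU fR.
Qed.

Lemma universal_derivation_exists (F G : groupType)
    (phi : {multiplicative F -> G}) :
  exists (D : gmodule G) (del : F -> D), universal_derivation phi del.
Proof.
(* e (u, g) is the element (del u)^g. *)
pose R (a b c : (F * G)%type) :=
  [/\ a.2 = (phi b.1 * b.2)%g, c.1 = (a.1 * b.1)%g & c.2 = b.2].
pose act (a : (F * G)%type) (g : G) := (a.1, (a.2 * g)%g).
have [||D [e [[eR eU] eact]]] := @universal_additive_gmodule _ R G act.
- by move=> [u a] [v b] [w c] g [/= -> -> ->]; split; rewrite //= mulgA.
- move=> A f _; rewrite /act.
  by split=> [[u a]|[u a] g h] /=; rewrite ?mulg1 ?mulgA.
have e_act u g : e (u, g) = gact (e (u, 1%g)) g by rewrite -eact /act mul1g.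
exists D, (fun u => e (u, 1%g)); split=> [u v|M d dP].
  by rewrite -e_act; apply: eR; split; rewrite /= ?mulg1.
have fR : additive_on R (fun a => gact (d a.1) a.2).
  by move=> [u a] [v b] [w c] [/= -> -> ->]; rewrite dP gactD -gactM.
have [h [hB he hU]] := eU _ _ fR.
exists h; split=> [|u|h' [h'B h'g] h'e].
- split=> // x g.
  have gB (N : gmodule G) k : zmod_morphism (@gact G N ^~ k).
    move=> y z; have g0 : gact (0 : N) k = 0.
      by apply: (addrI (gact 0 k)); rewrite addr0 -gactD addr0.
    have gN t : gact (- t : N) k = - gact t k.
      by apply: (addrI (gact t k)); rewrite -gactD !subrr g0.
    by rewrite gactD gN.
  have kR : additive_on R (fun a => gact (d a.1) (a.2 * g)%g).
    by move=> a b c /fR; rewrite !gactM => ->; rewrite gactD.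
  have [k [_ _ kU]] := eU _ _ kR.
  rewrite (kU (fun x => h (gact x g))).
  + rewrite (kU (fun x => gact (h x) g)) // => [y z|a].
      by rewrite hB gB.
    by rewrite he gactM.
  + by move=> y z; rewrite gB hB.
  + by move=> a; rewrite -eact he.
- by rewrite he gact1.
- apply: hU => // -[u g].
  by rewrite /= e_act h'g h'e.
Qed.

Lemma kernel_abelianisation_exists (F G : groupType)
    (phi : {multiplicative F -> G}) :
  (forall g, exists u, phi u = g) ->
  exists (A : gmodule G) (ab : kernel phi -> A), kernel_abelianisation ab.
Proof.
move=> /boolp.choice [s sP].
pose R (m n k : kernel phi) := k = (m * n)%g.
have addC (A : zmodType) (f : kernel phi -> A) : additive_on R f ->
    forall n u v, phi u = phi v -> f (kernel_conj n u) = f (kernel_conj n v).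
  move=> fR n u v uv; have fM m k : f (m * k)%g = f m + f k by apply: fR.
  have kw : kernel_pred phi (u^-1 * v)%g.
    by apply/eqP; rewrite gmulfM multV uv mulVg.
  pose w : kernel phi := Sub (u^-1 * v)%g kw.
  have e : (kernel_conj n u * w)%g = (w * kernel_conj n v)%g.
    by apply: val_inj; rewrite /= !conjgE !mulgA !mulgK.
  by apply: (addIr (f w)); rewrite -fM e fM addrC.
have [||A [e [[eR eU] eact]]] :=
    @universal_additive_gmodule _ R G (fun n g => kernel_conj n (s g)).
- by move=> m n _ g ->; apply: val_inj; rewrite /= conjMg.
- move=> A f fR; split=> [n|n g h].
    rewrite (addC _ _ fR _ _ 1%g) ?sP ?mult1 //; congr f.
    by apply: val_inj; rewrite /= conjg1.
  rewrite (addC _ _ fR _ _ (s g * s h)%g) ?gmulfM ?sP //; congr f.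
  by apply: val_inj; rewrite /= conjgM.
exists A, e; split; last first.
  by move=> n v; rewrite -eact; apply: (addC _ _ eR); rewrite sP.
split=> [m n|B f fM]; first by apply: eR.
by apply: eU => m n _ ->.
Qed.

(* Main.v *)
Require Import Defs.
From mathcomp Require Import all_boot ssralg ssrint boolp.
From mathcomp.multinomials Require Import freeg.

Set Implicit Arguments.
Unset Strict Implicit.
Unset Printing Implicit Defensive.

Import GRing.Theory.
Local Open Scope ring_scope.

(** A homomorphism from a groupoid to an abelian group is a function on
    morphisms that turns composites into sums.  For the groupoid of phi this
    reads e (u v, g) = e (u, phi(v) g) + e (v, g), and when g acts on the
    target with e (u, g) = e (u, 1)^g it says exactly that u |-> e (u, 1) is a
    phi-derivation.  So D_phi and the total abelianisation of the groupoid of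
    phi have the same universal property: [derived_hat_iso].  The covering
    groupoid has exactly one morphism (g, h) : gh -> h between any two objects,
    and sending it to gh - h identifies its total abelianisation with IG:
    [augmentation_covering_iso].

    It remains to see that the lower row is exact, and forgetting the G-action
    it even splits ([hat_short_exact]).  Let s be a set-theoretic section of
    phi.  The morphisms (s g, 1) : g -> 1 form a maximal tree in the groupoid
    of phi.  Conjugating along the tree retracts the groupoid onto the vertex
    group N at 1 and gives an additive map rho from the middle term to N^ab;
    the difference of the tree morphisms at the two ends of a morphism of the
    covering groupoid gives an additive map sigma in the other direction to q.
    The decomposition of a morphism into a tree morphism, a loop at 1 and an
    inverse tree morphism becomes x = j (rho x) + sigma (q x), and with
    rho j = id, q sigma = id and q j = 0 the row is split exact.  The upper row
    is the lower one carried back along the two isomorphisms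
    ([short_exact_transport]).  *)

(** * Additive maps and module morphisms *)

Section ZmodMorphism.
Variables (A B C : zmodType).

Lemma zmod_morphism_comp (h : B -> C) (f : A -> B) :
  zmod_morphism h -> zmod_morphism f -> zmod_morphism (h \o f).
Proof. by move=> hB fB x y; rewrite /= fB hB. Qed.

Lemma zmod_morphism0 (f : A -> B) : zmod_morphism f -> f 0 = 0.
Proof. by move=> fB; rewrite -{1}[0](subrr 0) fB subrr. Qed.

Lemma zmod_morphismD (f : A -> B) :
  zmod_morphism f -> {morph f : x y / x + y}.
Proof.
move=> fB x y; have fN : f (- y) = - f y.
  by rewrite -sub0r fB zmod_morphism0 // sub0r.
by rewrite -{1}[y]opprK fB fN opprK.
Qed.

Lemma morphD_zmod_morphism (f : A -> B) :
  {morph f : x y / x + y} -> zmod_morphism f.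
Proof. by move=> fD x y; apply: (addIr (f y)); rewrite -fD !subrK. Qed.

Lemma zmod_morphism_add (f g : A -> B) :
  zmod_morphism f -> zmod_morphism g -> zmod_morphism (fun x => f x + g x).
Proof. by move=> fB gB x y; rewrite fB gB opprD addrACA. Qed.

End ZmodMorphism.

Lemma gact_zmod_morphism (G : groupType) (M : gmodule G) g :
  zmod_morphism (fun x : M => gact x g).
Proof. by apply: morphD_zmod_morphism; apply: gactD. Qed.

Lemma zlift_comp (X : choiceType) (A B : zmodType) (h : A -> B) (f : X -> A) :
  zmod_morphism h -> forall z, h (zlift f z) = zlift (h \o f) z.
Proof.
move=> hB; apply: freeg_ext => [||x]; last by rewrite !zliftU.
- exact: zmod_morphism_comp hB (@zlift_is_zmod_morphism _ _ f).
- exact: zlift_is_zmod_morphism.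
Qed.

Section GModules.
Variable G : groupType.

Lemma gmodule_morphism_comp (M1 M2 M3 : gmodule G) (h : M2 -> M3)
    (f : M1 -> M2) :
  gmodule_morphism h -> gmodule_morphism f -> gmodule_morphism (h \o f).
Proof.
move=> [hB hg] [fB fg]; split=> [|x g]; first exact: zmod_morphism_comp.
by rewrite /= fg hg.
Qed.

Lemma gmodule_morphism_inv (M M' : gmodule G) (f : M -> M') (f' : M' -> M) :
  cancel f f' -> cancel f' f -> gmodule_morphism f -> gmodule_morphism f'.
Proof.
move=> fK f'K [fB fg]; split=> [x y|x g]; apply: (can_inj fK).
  by rewrite fB !f'K.
by rewrite fg !f'K.
Qed.

Lemma short_exact_transport (A B B' C C' : gmodule G) (j : A -> B')
    (q : B' -> C') (eta : B -> B') (etaV : B' -> B) (zeta : C' -> C)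
    (zetaV : C -> C') :
  cancel eta etaV -> cancel etaV eta -> gmodule_morphism eta ->
  cancel zeta zetaV -> cancel zetaV zeta -> gmodule_morphism zeta ->
  short_exact j q -> short_exact (etaV \o j) (zeta \o (q \o eta)).
Proof.
move=> etaK etaVK etaM zetaK zetaVK zetaM [jM qM j_inj jq q_surj].
split=> [||x y|b|c] /=.
- exact: gmodule_morphism_comp (gmodule_morphism_inv etaK etaVK etaM) jM.
- exact: gmodule_morphism_comp zetaM (gmodule_morphism_comp qM etaM).
- by move/(can_inj etaVK)/j_inj.
- have zeta0 := zmod_morphism0 zetaM.1.
  split=> [|[a <-]].
    rewrite -[in X in X -> _]zeta0 => /(can_inj zetaK)/jq [a aP].
    by exists a; rewrite aP etaK.
  by rewrite etaVK (_ : q (j a) = 0) //; apply/jq; exists a.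
- have [b bP] := q_surj (zetaV c).
  by exists (etaV b); rewrite etaVK bP zetaVK.
Qed.

End GModules.

(** * Total abelianisations and their universal property *)

Section TotalAbelianisation.
Variable H : groupoid.

Definition additive_functor (B : zmodType) (f : gmor H -> B) :=
  forall a b (ab : gtgt a = gsrc b), f (gcomp ab) = f a + f b.

Lemma groupoid_morphism_additive (B : zmodType)
  (f : groupoid_morphism H (ab_groupoid B)) : additive_functor f.
Proof.
move=> a b ab; have fab : gtgt (f a) = gsrc (f b) by [].
exact: (mmor_comp ab fab).
Qed.

Lemma additive_functor_comp (A B : zmodType) (h : A -> B) (f : gmor H -> A) :
  zmod_morphism h -> additive_functor f -> additive_functor (h \o f).
Proof. by move=> hB fD a b ab; rewrite /= fD zmod_morphismD. Qed.

(** Preservation of identities is automatic, because an identity is idempotent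
    and 0 is the only idempotent of a group. *)
Lemma additive_functor_morphism (B : zmodType) (f : gmor H -> B) :
  additive_functor f ->
  exists f' : groupoid_morphism H (ab_groupoid B), forall a, f' a = f a.
Proof.
move=> fD; have f_id p : f (gid p) = 0.
  have idp : gtgt (gid (gsrc (gid p : gmor H))) = gsrc (gid p).
    by rewrite gtgt_id.
  apply: (addrI (f (gid p))); rewrite addr0.
  by rewrite -{3}(gcomp1l idp) fD gsrc_id.
by exists (@GroupoidMorphism H (ab_groupoid B) (fun=> tt) f
  (fun=> erefl) (fun=> erefl) f_id (fun a b ab _ => fD a b ab)).
Qed.

Variables (T : zmodType) (iota : groupoid_morphism H (ab_groupoid T)).
Hypothesis iota_univ : universal_abelianisation iota.

Lemma totab_lift (B : zmodType) (f : gmor H -> B) :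
  additive_functor f ->
  exists2 h : T -> B, zmod_morphism h & forall a, h (iota a) = f a.
Proof.
move=> /additive_functor_morphism [f' f'E].
by have [h [hB hf _]] := iota_univ f'; exists h => // a; rewrite hf f'E.
Qed.

Lemma totab_ext (B : zmodType) (h h' : T -> B) :
  zmod_morphism h -> zmod_morphism h' ->
  (forall a, h (iota a) = h' (iota a)) -> h =1 h'.
Proof.
move=> hB h'B hh'.
have /additive_functor_morphism [f fE] :=
  additive_functor_comp h'B (groupoid_morphism_additive iota).
have [k [_ _ kU]] := iota_univ f.
by move=> x; rewrite (kU h) ?(kU h') // => a; rewrite fE ?hh'.
Qed.

End TotalAbelianisation.

(** The universal property of the total abelianisation among G-modules: both
    sides of the equivariance equation are additive in x and agree on the
    generators. *)
Lemma totab_lift_equivariant (G : groupType) (H : groupoid)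
    (act : groupoid_action G H) (T : gmodule G)
    (iota : groupoid_morphism H (ab_groupoid T)) (M : gmodule G)
    (f : gmor H -> M) :
  totab_module act iota -> additive_functor f ->
  (forall a k, f (act_mor act a k) = gact (f a) k) ->
  exists2 h : T -> M, gmodule_morphism h & forall a, h (iota a) = f a.
Proof.
move=> [iota_univ iota_act] fD f_act.
have [h hB hf] := totab_lift iota_univ fD.
exists h => //; split=> // x k.
apply: (totab_ext iota_univ (h := fun x => h (gact x k))
  (h' := fun x => gact (h x) k)) => [||a].
- exact: zmod_morphism_comp hB (@gact_zmod_morphism _ _ k).
- exact: zmod_morphism_comp (@gact_zmod_morphism _ _ k) hB.
- by rewrite -iota_act !hf f_act.
Qed.

(** * Composites in the two groupoids *)

Lemma hat_functorM (F G : groupType) (phi : {multiplicative F -> G})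
    (B : zmodType) (f : gmor (hat_groupoid phi) -> B) u v g :
  additive_functor f -> f ((u * v)%g, g) = f (u, (phi v * g)%g) + f (v, g).
Proof.
move=> fD.
exact: (fD (u, (phi v * g)%g : G) (v, g) erefl).
Qed.

Lemma covering_functorM (G : groupType) (B : zmodType)
    (f : gmor (covering_groupoid G) -> B) u v g :
  additive_functor f -> f ((u * v)%g, g) = f (u, (v * g)%g) + f (v, g).
Proof.
move=> fD.
exact: (fD (u, (v * g)%g : G) (v, g) erefl).
Qed.

Lemma covering_functor1 (G : groupType) (B : zmodType)
    (f : gmor (covering_groupoid G) -> B) g :
  additive_functor f -> f (1%g, g) = 0.
Proof.
move=> fD; apply: (addrI (f (1%g, g))); rewrite addr0.
by have := covering_functorM 1%g 1%g g fD; rewrite !mul1g => <-.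
Qed.

(** * The augmentation ideal as a total abelianisation *)

(** IG is generated by the elements g - 1: the additive map of ZG that sends g
    to g - 1 is z |-> z - deg z, which fixes the elements of degree 0. *)
Lemma zlift_aug_sub1 (G : groupType) (x : IG G) :
  zlift (@aug_sub1 G) (val x) = x.
Proof.
have sub1E (z : {freeg G}) :
    val (zlift (@aug_sub1 G) z) = z - << 1%g >> *~ deg z.
  apply: (freeg_ext (f := fun z => val (zlift (@aug_sub1 G) z))
    (g := fun z => z - << 1%g >> *~ deg z)) (z) => [y t|y t|g].
  - by rewrite raddfB.
  - by rewrite degB mulrzBr opprD addrACA -opprD.
  - by rewrite zliftU degU.
apply: val_inj; rewrite sub1E.
by have /eqP -> := valP x; rewrite mulr0z subr0.
Qed.

(** The map zeta sends (g, h) to (g - 1)^h = gh - h.  Its inverse is the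
    restriction to IG of the additive map of ZG sending g to the class of
    (g, 1) : g -> 1; on ZG it need not be equivariant, and its equivariance on IG
    comes from that of zeta. *)
Lemma augmentation_covering_iso (G : groupType) (T : gmodule G)
    (iota : groupoid_morphism (covering_groupoid G) (ab_groupoid T)) :
  totab_module (covering_action G) iota ->
  exists (theta : IG G -> T) (zeta : T -> IG G),
    [/\ gmodule_morphism zeta, cancel theta zeta, cancel zeta theta
      & forall g, theta (aug_sub1 g) = iota (g, 1%g)].
Proof.
move=> iota_univ; have iotaD := groupoid_morphism_additive iota.
pose f (a : gmor (covering_groupoid G)) : IG G := gact (aug_sub1 a.1) a.2.
have valf a : val (f a) = << (a.1 * a.2)%g >> - << a.2 >>.
  by rewrite /= freeg_mulrB !freeg_mulrU mul1g.
have fD : additive_functor f.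
  move=> [g h] [g' h'] ab; apply: val_inj; rewrite raddfD.
  move: (valf (g, h)) (valf (g', h')) (valf ((g * g')%g, h')) => /= -> -> ->.
  by rewrite /= in ab; rewrite ab mulgA addrA subrK.
have fact a k : f (act_mor (covering_action G) a k) = gact (f a) k.
  by rewrite /f /= aug_actM.
have [zeta zetaM zetaE] := totab_lift_equivariant iota_univ fD fact.
pose lift := zlift (fun g => iota (g, 1%g)).
pose theta (x : IG G) : T := lift (val x).
have liftB : zmod_morphism lift by exact: zlift_is_zmod_morphism.
have thetaB : zmod_morphism theta by move=> x y; rewrite /theta raddfB liftB.
exists theta, zeta; split=> // [x|x|g].
- rewrite /theta /lift (zlift_comp _ zetaM.1) -[RHS]zlift_aug_sub1.
  congr (zlift _ _); apply/funext => g /=.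
  by rewrite zetaE /f gact1.
- apply: (totab_ext iota_univ.1 (h := theta \o zeta) (h' := id)) x => //.
    exact: zmod_morphism_comp thetaB zetaM.1.
  move=> [g h] /=; rewrite zetaE /theta valf liftB /lift !zliftU /=.
  by rewrite (covering_functorM _ _ _ iotaD) mulg1 addrK.
- rewrite /theta liftB /lift !zliftU.
  by rewrite (covering_functor1 _ iotaD) subr0.
Qed.

(** * The derived module as a total abelianisation *)

Lemma derived_ext (F G : groupType) (phi : F -> G) (D : gmodule G)
    (del : F -> D) (M : gmodule G) (h h' : D -> M) :
  universal_derivation phi del -> gmodule_morphism h -> gmodule_morphism h' ->
  (forall u, h (del u) = h' (del u)) -> h =1 h'.
Proof.
move=> [delD del_univ] hM h'M hh'.
have dD : derivation phi (h' \o del).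
  by move=> u v; rewrite /= delD (zmod_morphismD h'M.1) h'M.2.
have [k [_ _ kU]] := del_univ _ _ dD.
by move=> x; rewrite (kU h) ?(kU h').
Qed.

(** By (u, g) = (u, 1)^g the equivariant additive functors on the groupoid of
    phi are the maps (u, g) |-> d(u)^g with d a phi-derivation. *)
Lemma derived_hat_iso (F G : groupType) (phi : {multiplicative F -> G})
    (D : gmodule G) (del : F -> D) (T : gmodule G)
    (iota : groupoid_morphism (hat_groupoid phi) (ab_groupoid T)) :
  universal_derivation phi del -> totab_module (hat_action phi) iota ->
  exists (eta : D -> T) (etaV : T -> D),
    [/\ gmodule_morphism eta, cancel eta etaV, cancel etaV eta
      & forall u, eta (del u) = iota (u, 1%g)].
Proof.
move=> del_univ iota_univ; have iotaD := groupoid_morphism_additive iota.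
have iota_act u g : iota (u, g) = gact (iota (u, 1%g)) g.
  by rewrite -iota_univ.2 /= mul1g.
have dD : derivation phi (fun u => iota (u, 1%g) : T).
  by move=> u v; rewrite (hat_functorM _ _ _ iotaD) mulg1 iota_act.
have [eta [etaM etaE _]] := del_univ.2 _ _ dD.
pose f (a : gmor (hat_groupoid phi)) : D := gact (del a.1) a.2.
have fD : additive_functor f.
  move=> [u g] [v h] /= ->.
  by rewrite /f /= del_univ.1 gactD gactM.
have fact a k : f (act_mor (hat_action phi) a k) = gact (f a) k.
  by rewrite /f /= gactM.
have [etaV etaVM etaVE] := totab_lift_equivariant iota_univ fD fact.
exists eta, etaV; split=> // x.
- apply: (derived_ext del_univ (h := etaV \o eta) (h' := id)) x => // [|u].
    exact: gmodule_morphism_comp.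
  by rewrite /= etaE etaVE /f gact1.
- apply: (totab_ext iota_univ.1 (h := eta \o etaV) (h' := id)) x => // [|a].
    exact: zmod_morphism_comp etaM.1 etaVM.1.
  rewrite /= etaVE /f etaM.2 etaE -iota_act.
  by case: a.
Qed.

(** * The exact sequence of the groupoid of phi *)

Lemma abelianisation_ext (N : groupType) (A B : zmodType) (ab : N -> A)
    (h h' : A -> B) :
  group_abelianisation ab -> zmod_morphism h -> zmod_morphism h' ->
  (forall n, h (ab n) = h' (ab n)) -> h =1 h'.
Proof.
move=> [abM ab_univ] hB h'B hh'.
have fM : {morph (h' \o ab) : m n / (m * n)%g >-> m + n}.
  by move=> m n; rewrite /= abM (zmod_morphismD h'B).
have [k [_ _ kU]] := ab_univ _ _ fM.
by move=> x; rewrite (kU h) ?(kU h').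
Qed.

Section HatSequence.
Variables (F G : groupType) (phi : {multiplicative F -> G}).
Hypothesis phi_epi : forall g : G, exists u : F, phi u = g.
Variables (Nab : gmodule G) (ab : kernel phi -> Nab).
Hypothesis Nab_univ : kernel_abelianisation ab.
Variables (hatT : gmodule G)
  (hat_iota : groupoid_morphism (hat_groupoid phi) (ab_groupoid hatT)).
Hypothesis hatT_univ : totab_module (hat_action phi) hat_iota.
Variables (covT : gmodule G)
  (cov_iota : groupoid_morphism (covering_groupoid G) (ab_groupoid covT)).
Hypothesis covT_univ : totab_module (covering_action G) cov_iota.

Let hatD := groupoid_morphism_additive hat_iota.
Let covD := groupoid_morphism_additive cov_iota.

(** Equivariance holds because v (v^-1 n v) = n v in F: the class of
    (v^-1 n v, 1) is that of (n, phi v), conjugated by the path (v, 1) whose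
    class cancels. *)
Lemma hat_kernel_map :
  exists2 j : Nab -> hatT, gmodule_morphism j
    & forall n, j (ab n) = hat_iota (val n, 1%g).
Proof.
have fM : {morph (fun n : kernel phi => hat_iota (val n, 1%g) : hatT)
    : m n / (m * n)%g >-> m + n}.
  move=> m n; rewrite (hat_functorM _ _ _ hatD).
  by have /eqP -> := valP n; rewrite mulg1.
have [j [jB jE _]] := Nab_univ.1.2 _ _ fM.
exists j => //; split=> // x g; have [v <-] := phi_epi g.
apply: (abelianisation_ext Nab_univ.1 (h := fun x => j (gact x (phi v)))
  (h' := fun x => gact (j x) (phi v))) => [||n].
- exact: zmod_morphism_comp jB (@gact_zmod_morphism _ _ _).
- exact: zmod_morphism_comp (@gact_zmod_morphism _ _ _) jB.
rewrite Nab_univ.2 !jE -hatT_univ.2 /= mul1g.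
apply: (addrI (hat_iota (v, 1%g))).
have := hat_functorM v (val n ^ v)%g 1%g hatD.
have /eqP -> := kernel_conj_subproof n v.
rewrite mulg1 => <-; rewrite addrC.
have := hat_functorM (val n) v 1%g hatD; rewrite mulg1 => <-.
by rewrite conjgE mulVKg.
Qed.

Lemma hat_bar_map :
  exists2 q : hatT -> covT, gmodule_morphism q
    & forall a, q (hat_iota a) = cov_iota (hat_bar phi a).
Proof.
apply: totab_lift_equivariant hatT_univ _ _ => [[u g] [v h] /= e|a k].
  by rewrite gmulfM (covering_functorM _ _ _ covD) e.
by rewrite -covT_univ.2.
Qed.

(** The tree of the morphisms (s g, 1) : g -> 1 splits the sequence as a
    sequence of abelian groups; rho and sigma depend on s and are in general
    not equivariant. *)
Lemma hat_short_exact (j : Nab -> hatT) (q : hatT -> covT) :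
  gmodule_morphism j -> (forall n, j (ab n) = hat_iota (val n, 1%g)) ->
  gmodule_morphism q ->
  (forall a, q (hat_iota a) = cov_iota (hat_bar phi a)) ->
  short_exact j q.
Proof.
move=> jM jE qM qE.
have /boolp.choice [s sP] := phi_epi.
(* The loop at 1 obtained from a by conjugating along the tree. *)
have kP (a : gmor (hat_groupoid phi)) :
    kernel_pred phi ((s (gsrc a))^-1 * a.1 * s (gtgt a))%g.
  by apply/eqP; rewrite !gmulfM multV !sP /= -mulgA mulVg.
pose r a : kernel phi := Sub _ (kP a).
have rD : additive_functor (ab \o r).
  move=> [u g] [v h] /= e; rewrite -Nab_univ.1.1; congr (ab _).
  by apply: val_inj; rewrite /= e gmulfM !mulgA mulgK.
have [rho rhoB rhoE] := totab_lift hatT_univ.1 rD.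
pose c (a : gmor (covering_groupoid G)) : hatT :=
  hat_iota (s (gsrc a), 1%g) - hat_iota (s (gtgt a), 1%g).
have cD : additive_functor c.
  by move=> a b e; rewrite /c gsrc_comp gtgt_comp e addrA subrK.
have [sigma sigmaB sigmaE] := totab_lift covT_univ.1 cD.
have rhoj x : rho (j x) = x.
  apply: (abelianisation_ext Nab_univ.1 (h := rho \o j) (h' := id)) x => //.
    exact: zmod_morphism_comp rhoB jM.1.
  move=> n /=; rewrite jE rhoE /=.
  have n1 : phi (val n) = 1%g by have /eqP := valP n.
  (* s 1 need not be 1, but conjugation by s 1 acts on N^ab as phi (s 1) = 1. *)
  rewrite -[RHS]gact1 -[in RHS](sP 1%g) Nab_univ.2; congr (ab _).
  by apply: val_inj; rewrite /= conjgE n1 mulg1 mulgA.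
have qsigma x : q (sigma x) = x.
  apply: (totab_ext covT_univ.1 (h := q \o sigma) (h' := id)) x => //.
    exact: zmod_morphism_comp qM.1 sigmaB.
  move=> [g h] /=; rewrite sigmaE /c qM.1 !qE /= !sP.
  by rewrite (covering_functorM _ _ _ covD) mulg1 addrK.
(* On generators: s (phi u g) times the loop of (u, g) equals u (s g) in F. *)
have split_hat x : x = j (rho x) + sigma (q x).
  apply: (totab_ext hatT_univ.1 (h := id)
    (h' := fun x => j (rho x) + sigma (q x))) x => //.
    apply: zmod_morphism_add; first exact: zmod_morphism_comp jM.1 rhoB.
    exact: zmod_morphism_comp sigmaB qM.1.
  move=> [u g] /=; rewrite rhoE /= jE qE sigmaE /c /=.
  rewrite addrA; apply: (addIr (hat_iota (s g, 1%g))); rewrite subrK.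
  have := hat_functorM u (s g) 1%g hatD; rewrite sP mulg1 => <-.
  have /eqP n1 := kP (u, g).
  have := hat_functorM (s (phi u * g)%g) ((s (phi u * g))^-1 * u * s g)%g 1%g
    hatD.
  by rewrite n1 mulg1 addrC => <-; rewrite !mulgA mulgV mul1g.
have qj x : q (j x) = 0.
  apply: (abelianisation_ext Nab_univ.1 (h := q \o j) (h' := fun=> 0)) x.
  - exact: zmod_morphism_comp qM.1 jM.1.
  - by move=> x y; rewrite subrr.
  - move=> n /=; rewrite jE qE /=; have /eqP -> := valP n.
    exact: covering_functor1.
split=> // [|b|x].
- exact: can_inj rhoj.
- split=> [qb|[a <-]]; last exact: qj.
  exists (rho b).
  by rewrite [RHS]split_hat qb (zmod_morphism0 sigmaB) addr0.
- by exists (sigma x).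
Qed.

End HatSequence.

Theorem theorem4p1 (F G : groupType) (phi : {multiplicative F -> G})
    (phi_epi : forall g : G, exists u : F, phi u = g)
    (* N^ab, the derived module D_phi, and the two universal abelianisations *)
    (Nab : gmodule G) (ab : kernel phi -> Nab)
    (Nab_univ : kernel_abelianisation ab)
    (D : gmodule G) (del : F -> D)
    (D_univ : universal_derivation phi del)
    (hatT : gmodule G)
    (hat_iota : groupoid_morphism (hat_groupoid phi) (ab_groupoid hatT))
    (hatT_univ : totab_module (hat_action phi) hat_iota)
    (covT : gmodule G)
    (cov_iota : groupoid_morphism (covering_groupoid G) (ab_groupoid covT))
    (covT_univ : totab_module (covering_action G) cov_iota) :
  exists (i : Nab -> D) (p : D -> IG G) (j : Nab -> hatT) (q : hatT -> covT),
    (* the maps in the rows *)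
    [/\ forall n : kernel phi, i (ab n) = del (val n),
        forall u : F, p (del u) = aug_sub1 (phi u),
        forall n : kernel phi, j (ab n) = hat_iota (val n, 1%g)
      & forall a : gmor (hat_groupoid phi),
          q (hat_iota a) = cov_iota (hat_bar phi a)] /\
    (* both rows are exact sequences of G-modules *)
    short_exact i p /\ short_exact j q /\
    (* the isomorphism of exact sequences, the identity on N^ab *)
    exists (eta : D -> hatT) (theta : IG G -> covT),
      [/\ gmodule_isomorphism eta, gmodule_isomorphism theta,
          forall x : Nab, eta (i x) = j x
        & forall d : D, theta (p d) = q (eta d)] /\
      (* naturality: eta and theta are the canonical maps on generators *)
      (forall u : F, eta (del u) = hat_iota (u, 1%g)) /\
      (forall g : G, theta (aug_sub1 g) = cov_iota (g, 1%g)).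
Proof.
have [j jM jE] := hat_kernel_map phi_epi Nab_univ hatT_univ.
have [q qM qE] := hat_bar_map hatT_univ covT_univ.
have [eta [etaV [etaM etaK etaVK etaE]]] := derived_hat_iso D_univ hatT_univ.
have [theta [zeta [zetaM thetaK zetaK thetaE]]] :=
  augmentation_covering_iso covT_univ.
have jq := hat_short_exact phi_epi Nab_univ hatT_univ covT_univ jM jE qM qE.
have thetaM := gmodule_morphism_inv zetaK thetaK zetaM.
exists (etaV \o j), (zeta \o (q \o eta)), j, q; split.
  split=> // [n|u] /=; first by rewrite jE -etaE etaK.
  by rewrite etaE qE /= -thetaE thetaK.
split; first exact: short_exact_transport.
split=> //; exists eta, theta; split=> //.
split=> [||x|d] /=; rewrite ?etaVK ?zetaK //.
- by split=> //; exists etaV.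
- by split=> //; exists zeta.
Qed.
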